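(* Let $X_\Sigma$ be a projective toric variety with $\Sigma$ simplicial and a fixed polarization $H$. Let $\mathcal E=(\mathcal M,\mathcal G,\{E^i(j)\})$ be a tropical toric reflexive sheaf on $\operatorname{trop}(X_\Sigma)$, and assume that all $E^i(j)$ are modular flats of the lattice of flats of $\underline{\mathcal M}$. Then there is an increasing filtration by flats of the underlying matroid $\underline{\mathcal M}$ $$\emptyset=F_0\subsetneq F_1\subsetneq F_2\subsetneq\dots\subsetneq F_k=\mathcal G$$ such that the quotients $\mathrm{gr}_i:=\mathcal E_{F_i/F_{i-1}}$, $i=1,\dots,k$, satisfy: (i) each $\mathrm{gr}_i$ is semistable, and (ii) $\mu(\mathrm{gr}_i)>\mu(\mathrm{gr}_{i+1})$ for $i=1,\dots,k-1$. This filtration is unique under the additional assumption that the flats $F_1,\dots,F_k$ are also modular; that is, there is at most one filtration satisfying (i) and (ii) all of whose members are modular flats.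
   Context: $\Sigma$ has rays $\rho_1,\dots,\rho_s$ and torus-invariant divisors $D_i$; $n=\dim X_\Sigma$. A valuated matroid $\mathcal M$ of rank $r$ on a finite set $\mathcal G$ is given by $\nu:\binom{\mathcal G}{r}\to\mathbb R\cup\{\infty\}$, not identically $\infty$, such that for all $B_1,B_2$ and $a\in B_1\setminus B_2$ there is $b\in B_2\setminus B_1$ with $\nu(B_1)+\nu(B_2)\ge\nu(B_1\setminus\{a\}\cup\{b\})+\nu(B_2\setminus\{b\}\cup\{a\})$; the underlying matroid $\underline{\mathcal M}$ has bases $\{B:\nu(B)\ne\infty\}$, with lattice of flats $\mathcal L(\underline{\mathcal M})$ ($\wedge$ = intersection, $\vee$ = smallest flat containing the union). A flat $x$ is modular if $\operatorname{rk}(x\vee y)+\operatorname{rk}(x\wedge y)=\operatorname{rk}(x)+\operatorname{rk}(y)$ for all flats $y$. Restriction $\mathcal M|_F$ and contraction $\mathcal M/F$ of valuated matroids have underlying matroids $\underline{\mathcal M}|_F$, $\underline{\mathcal M}/F$, with lattices of flats $[\emptyset,F]$ and (isomorphic to) $[F,\mathcal G]$; the rank in $\underline{\mathcal M}/F$ of the flat corresponding to $x\in[F,\mathcal G]$ is $\operatorname{rk}(x)-\operatorname{rk}(F)$. A tropical toric reflexive sheaf $(\mathcal M,\mathcal G,\{E^i(j)\})$ consists of a valuated matroid $\mathcal M$ on $\mathcal G$ with $\underline{\mathcal M}$ simple, and for each $1\le i\le s$ flats $E^i(j)$ ($j\in\mathbb Z$) with $E^i(j)\le E^i(j')$ if $j>j'$,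 $E^i(j)=\emptyset$ for $j\gg0$, $E^i(j)=\mathcal G$ for $j\ll0$. For a flat $F$: $\mathcal E_F=(\mathcal M|_F,F,\{E^i(j)\wedge F\})$; for flats $F\subseteq F'$ the quotient of $\mathcal E_{F'}$ by $\mathcal E_F$ is $\mathcal E_{F'/F}=((\mathcal M|_{F'})/F,\,F'\setminus F,\,\{(E^i(j)\wedge F')\vee F\})$ (flats of $(\underline{\mathcal M}|_{F'})/F$ identified with elements of $[F,F']$). Polarization: an ample line bundle $H$; $h_i=D_i\cdot H^{n-1}$; $\deg(\mathcal E)=\sum_{i=1}^s\sum_{j\in\mathbb Z}j\,(\operatorname{rk}E^i(j)-\operatorname{rk}E^i(j+1))\,h_i$, $\mu(\mathcal E)=\deg(\mathcal E)/\operatorname{rk}(\mathcal E)$ (ranks in the matroid of the sheaf in question). $\mathcal E$ is semistable if $\mu(\mathcal E_F)\le\mu(\mathcal E)$ for all proper nonempty flats $F$. *)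

(* Defs.v *)
From HB Require Import structures.
From mathcomp Require Import all_boot all_order all_algebra.
From mathcomp Require Import mpoly.
From mathcomp Require Import classical_sets fsbigop reals constructive_ereal.
(* [set0], [subsetP], etc. are about finite sets again. *)
From mathcomp Require Import fintype finset.

Set Implicit Arguments.
Unset Strict Implicit.
Unset Printing Implicit Defensive.

Import Order.TTheory GRing.Theory Num.Theory.
Local Open Scope ring_scope.

(** * Complete simplicial fans, ample divisors, intersection numbers *)

Definition primitive_vector n (u : 'rV[int]_n) : Prop :=
  forall (c : int) (w : 'rV[int]_n), u = c *: w -> `|c| = 1.

Definition pairing n (m u : 'rV[int]_n) : int := \sum_(k < n) m 0 k * u 0 k.

Definition real_vector (R : realType) n (u : 'rV[int]_n) : 'rV[R]_n :=
  map_mx intr u.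

Definition in_cone (R : realType) n s (u : 'I_s -> 'rV[int]_n)
    (sigma : {set 'I_s}) (v : 'rV[R]_n) : Prop :=
  exists2 c : 'I_s -> R, (forall i, 0 <= c i)
    & v = \sum_(i in sigma) c i *: real_vector R (u i).

(** The lattice is N = Z^n, with N_R = R^n.  A fan is given by the primitive
    generators of its rays and by the sets of (indices of) rays that span a
    cone. *)
Record simplicial_fan (R : realType) (n s : nat) := SimplicialFan {
  ray : 'I_s -> 'rV[int]_n;
  cones : {set {set 'I_s}};
  ray_primitive : forall i, primitive_vector (ray i);
  cones_zero : set0 \in cones;
  cones_ray : forall i, [set i] \in cones;
  cones_face : forall sigma tau : {set 'I_s},
    sigma \in cones -> tau \subset sigma -> tau \in cones;
  cones_simplicial : forall sigma, sigma \in cones ->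
    free [seq real_vector R (ray i) | i <- enum sigma];
  cones_inter : forall sigma tau, sigma \in cones -> tau \in cones ->
    forall v, in_cone ray sigma v -> in_cone ray tau v ->
      in_cone (R := R) ray (sigma :&: tau) v
}.

Definition complete_fan (R : realType) n s (Sigma : simplicial_fan R n s) :
    Prop :=
  forall v : 'rV[R]_n,
    exists2 sigma, sigma \in cones Sigma & in_cone (ray Sigma) sigma v.

(** [a] stands for the torus-invariant divisor \sum_i a_i D_i, and every line
    bundle on the toric variety is the class of such a (Cartier) divisor.  The
    vectors [m] are its Cartier data on the maximal cones; the divisor is ample
    when the support function [v |-> <m, v>] (for v in sigma) is strictly
    convex. *)
Definition ample (R : realType) n s (Sigma : simplicial_fan R n s)
    (a : 'I_s -> int) : Prop :=
  forall sigma : {set 'I_s}, maxset (mem (cones Sigma)) sigma ->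
    exists m : 'rV[int]_n,
      (forall i, i \in sigma -> pairing m (ray Sigma i) = - a i) /\
      (forall i, i \notin sigma -> - a i < pairing m (ray Sigma i)).

(** Rational intersection numbers on the complete simplicial toric variety.
    Its rational Chow ring is the quotient of Q['X_1, ..., 'X_s] (with 'X_i the
    class of D_i) by the Stanley-Reisner ideal and by the divisors of
    characters \sum_i <m, u_i> D_i; its degree map is the linear form which
    takes the value 1 / mult(sigma) on the product of the D_i, i in sigma, for
    every n-dimensional cone sigma.  Such a form is unique in degree n, the only
    degree in which it is used below. *)
Record chow_degree (R : realType) n s (Sigma : simplicial_fan R n s) :=
  ChowDegree {
  chow_deg :> {scalar {mpoly rat[s]}};
  chow_deg_nonface : forall (A : {set 'I_s}) (p : {mpoly rat[s]}),
    A \notin cones Sigma -> chow_deg (p * \prod_(i in A) 'X_i) = 0;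
  chow_deg_principal : forall (m : 'rV[int]_n) (p : {mpoly rat[s]}),
    chow_deg (p * \sum_(i < s) (pairing m (ray Sigma i))%:~R *: 'X_i) = 0;
  chow_deg_cone : forall f : 'I_n -> 'I_s, injective f ->
    [set f k | k : 'I_n] \in cones Sigma ->
    chow_deg (\prod_(k < n) 'X_(f k)) =
      (`|\det (\matrix_(k < n) ray Sigma (f k))|%:~R)^-1
}.

(** [curve_degree d H i] is D_i . H^(n-1). *)
Definition curve_degree (R : realType) n s (Sigma : simplicial_fan R n s)
    (d : chow_degree Sigma) (H : 'I_s -> int) (i : 'I_s) : rat :=
  d ('X_i * (\sum_(j < s) (H j)%:~R *: 'X_j) ^+ n.-1).

(** * Valuated matroids *)

(** The valuation is extended by +oo to the sets that are not r-subsets of the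
    ground set. *)
Record valuated_matroid (R : realType) (T : finType) := ValuatedMatroid {
  ground : {set T};
  vrank : nat;
  nu : {set T} -> \bar R;
  nu_support : forall B, nu B != +oo%E -> B \subset ground /\ #|B| = vrank;
  nu_neq_ninfty : forall B, nu B != -oo%E;
  nu_nontrivial : exists B, nu B != +oo%E;
  nu_exchange : forall (B1 B2 : {set T}) a,
    B1 \subset ground -> #|B1| = vrank -> B2 \subset ground -> #|B2| = vrank ->
    a \in B1 :\: B2 ->
    exists2 b, b \in B2 :\: B1
      & (nu (b |: (B1 :\ a)) + nu (a |: (B2 :\ b)) <= nu B1 + nu B2)%E
}.

Section UnderlyingMatroid.
Variables (R : realType) (T : finType) (M : valuated_matroid R T).
Implicit Types (B F X x y : {set T}).

Definition basis B : bool := nu M B != +oo%E.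

Definition rk X : nat := \max_(B : {set T} | basis B) #|B :&: X|.

Definition simple_matroid : Prop :=
  (forall e, e \in ground M -> rk [set e] = 1%N) /\
  (forall e f, e \in ground M -> f \in ground M -> e != f ->
     rk [set e; f] = 2%N).

Definition flat F : bool :=
  (F \subset ground M) &&
  [forall e in ground M :\: F, (rk F < rk (e |: F))%N].

Definition join x y : {set T} := \bigcap_(F | flat F && (x :|: y \subset F)) F.

Definition modular_flat x : Prop :=
  flat x /\
  forall y, flat y -> (rk (join x y) + rk (x :&: y) = rk x + rk y)%N.

Definition some_basis : {set T} := xchoose (nu_nontrivial M).

(** A basis B such that B :&: F is a basis of F. *)
Definition adapted_basis F : {set T} :=
  [arg max_(B > some_basis | basis B) #|B :&: F|].

Lemma adapted_basisP F : basis (adapted_basis F).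
Proof.
by rewrite /adapted_basis; case: arg_maxnP => //; apply: (xchooseP (nu_nontrivial M)).
Qed.

(** Both minors are of the form B |-> nu (B :|: (B0 :\: D)) for B inside D. *)
Variables (D B0 : {set T}).

Definition minor_nu B : \bar R :=
  if B \subset D then nu M (B :|: (B0 :\: D)) else +oo%E.

Lemma card_minor B : B \subset D ->
  #|B :|: (B0 :\: D)| = (#|B| + #|B0 :\: D|)%N.
Proof.
move=> sBD; rewrite cardsU (_ : B :&: _ = set0) ?cards0 ?subn0 //.
apply/setP=> e; rewrite !inE; case: (boolP (e \in B)) => //= eB.
by rewrite (subsetP sBD _ eB).
Qed.

Hypothesis B0P : basis B0.

Lemma minor_support B : minor_nu B != +oo%E ->
  B \subset ground M :&: D /\ #|B| = #|B0 :&: D|.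
Proof.
rewrite /minor_nu; case: ifP => // sBD /(@nu_support _ _ M)[sBG cB].
have [_ cB0] := nu_support B0P.
split; first by rewrite subsetI sBD (subset_trans (subsetUl _ _) sBG).
by apply/eqP; rewrite -(eqn_add2r #|B0 :\: D|) -card_minor // cB -cB0 cardsID.
Qed.

Lemma minor_neq_ninfty B : minor_nu B != -oo%E.
Proof. by rewrite /minor_nu; case: ifP => // _; apply: nu_neq_ninfty. Qed.

Lemma minor_nontrivial : exists B, minor_nu B != +oo%E.
Proof. by exists (B0 :&: D); rewrite /minor_nu subsetIr setID. Qed.

Lemma minor_exchange (B1 B2 : {set T}) a :
  B1 \subset ground M :&: D -> #|B1| = #|B0 :&: D| ->
  B2 \subset ground M :&: D -> #|B2| = #|B0 :&: D| ->
  a \in B1 :\: B2 ->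
  exists2 b, b \in B2 :\: B1
    & (minor_nu (b |: (B1 :\ a)) + minor_nu (a |: (B2 :\ b))
       <= minor_nu B1 + minor_nu B2)%E.
Proof.
rewrite !subsetI => /andP[s1G s1D] c1 /andP[s2G s2D] c2.
rewrite inE => /andP[aN2 a1].
have [sB0G cB0] := nu_support B0P.
have sC : B0 :\: D \subset ground M by rewrite (subset_trans (subsetDl _ _)).
have aD := subsetP s1D _ a1.
have [|||||b] := @nu_exchange _ _ M (B1 :|: (B0 :\: D)) (B2 :|: (B0 :\: D)) a.
- by rewrite subUset s1G.
- by rewrite card_minor // c1 -cB0 cardsID.
- by rewrite subUset s2G.
- by rewrite card_minor // c2 -cB0 cardsID.
- by rewrite !inE aD (negbTE aN2) a1.
rewrite !inE; case: (boolP (b \in D)) => /= bD; last first.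
  by case/andP=> /norP[_ /negbTE ->]; rewrite orbF => /(subsetP s2D); rewrite (negbTE bD).
rewrite !orbF => /andP[bN1 b2] le_nu.
exists b; first by rewrite inE bN1.
have sub e f B : e \in D -> B \subset D -> e |: (B :\ f) \subset D.
  by move=> eD sB; rewrite subUset sub1set eD (subset_trans (subsetDl _ _)).
rewrite /minor_nu !sub // s1D s2D.
have shift e f B : f \in D ->
    (e |: (B :\ f)) :|: (B0 :\: D) = e |: ((B :|: (B0 :\: D)) :\ f).
  move=> fD; apply/setP=> z; rewrite !inE.
  by case: (eqVneq z f) => [->|_] /=; rewrite ?fD ?orbF // orbA.
by rewrite !shift.
Qed.

Definition minor : valuated_matroid R T :=
  ValuatedMatroid minor_support minor_neq_ninfty minor_nontrivial
    minor_exchange.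

End UnderlyingMatroid.

(** M|F: nu_F (B) = nu (B :|: A) for B inside F, where A is disjoint from F and
    completes a basis of F to a basis of M.
    M/F: nu_F (B) = nu (B :|: A) for B disjoint from F, where A is a basis of F.
    Another choice of A changes the valuation by an additive constant only. *)
Definition restriction (R : realType) (T : finType)
    (M : valuated_matroid R T) (F : {set T}) : valuated_matroid R T :=
  minor F (adapted_basisP M F).

Definition contraction (R : realType) (T : finType)
    (M : valuated_matroid R T) (F : {set T}) : valuated_matroid R T :=
  minor (~: F) (adapted_basisP M F).

(** * Tropical toric reflexive sheaves *)

(** The data (M, G, {E^i(j)}), before any condition is imposed.  The quotients
    E_{F'/F} need not have a simple underlying matroid. *)
Record sheaf_data (R : realType) (T : finType) (s : nat) := SheafData {
  vmat : valuated_matroid R T;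
  filt : 'I_s -> int -> {set T}
}.

Definition tropical_toric_reflexive_sheaf (R : realType) (T : finType) s
    (E : sheaf_data R T s) : Prop :=
  [/\ simple_matroid (vmat E),
      forall i j, flat (vmat E) (filt E i j),
      forall i j j', j' < j -> filt E i j \subset filt E i j',
      forall i, exists N : int, forall j, N <= j -> filt E i j = set0
    & forall i, exists N : int, forall j, j <= N ->
        filt E i j = ground (vmat E)].

Section Stability.
Variables (R : realType) (T : finType) (s : nat).
Implicit Types (E : sheaf_data R T s) (F : {set T}).

Definition subsheaf E F : sheaf_data R T s :=
  SheafData (restriction (vmat E) F) (fun i j => filt E i j :&: F).

(** The flat of (M|F')/F that corresponds to x in [F, F'] is x :\: F. *)
Definition quotient E F' F : sheaf_data R T s :=
  SheafData (contraction (restriction (vmat E) F') F)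
    (fun i j => join (vmat E) (filt E i j :&: F') F :\: F).

Variable h : 'I_s -> rat.

Definition jump E (i : 'I_s) (j : int) : rat :=
  j%:~R * ((rk (vmat E) (filt E i j))%:R - (rk (vmat E) (filt E i (j + 1)))%:R).

(** The sum over Z has finite support for a tropical toric reflexive sheaf and
    for its subsheaves and quotients. *)
Definition sheaf_degree E : rat :=
  \sum_(i < s) (\sum_(j \in [set: int]%classic) jump E i j) * h i.

Definition slope E : rat := sheaf_degree E / (vrank (vmat E))%:R.

Definition semistable E : Prop :=
  forall F, flat (vmat E) F -> F != set0 -> F \proper ground (vmat E) ->
    slope (subsheaf E F) <= slope E.

(** [Fs] is the sequence F_1, ..., F_k; F_0 is [set0], and [graded E Fs i] is
    the quotient of E_{F_(i+1)} by E_{F_i}, for 0 <= i < k. *)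
Definition graded E (Fs : seq {set T}) (i : nat) : sheaf_data R T s :=
  quotient E (nth set0 (set0 :: Fs) i.+1) (nth set0 (set0 :: Fs) i).

Definition flat_filtration E (Fs : seq {set T}) : Prop :=
  [/\ forall F, F \in set0 :: Fs -> flat (vmat E) F,
      path (fun A B : {set T} => A \proper B) set0 Fs
    & last set0 Fs = ground (vmat E)].

Definition Harder_Narasimhan E (Fs : seq {set T}) : Prop :=
  [/\ flat_filtration E Fs,
      forall i, (i < size Fs)%N -> semistable (graded E Fs i)
    & forall i, (i.+1 < size Fs)%N ->
        slope (graded E Fs i.+1) < slope (graded E Fs i)].

End Stability.

(* Main.v *)
(** On ranks, modularity of the E^i(j) makes the degree of E_{F'/F} equal to
    deg E_{F'} - deg E_F, so that a Harder-Narasimhan filtration is a chain of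
    flats that is semistable and of decreasing slopes for the single function
    F |-> deg E_F.  Existence is then greedy: F_{i+1} has maximal slope over
    F_i, and is as large as possible.  For uniqueness, the numbers
    h_i = D_i.H^(n-1) are nonnegative since H is ample, hence
    deg E_{F \/ x} + deg E_{F /\ x} >= deg E_F + deg E_x for F modular; by
    induction along the chain every flat x satisfies deg E_x <= mu(gr_1) rk x,
    with equality only for x below F_1, which determines F_1. *)

Require Import Defs.
From mathcomp Require Import reals.
From mathcomp Require Import all_boot all_order all_algebra.
From mathcomp Require Import mpoly.
From mathcomp Require Import classical_sets fsbigop constructive_ereal.
From mathcomp Require Import fintype finset.
From mathcomp Require Import zify ring lra.

Set Implicit Arguments.
Unset Strict Implicit.
Unset Printing Implicit Defensive.

Import Order.TTheory GRing.Theory Num.Theory.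

(** * Rank and flats of the underlying matroid *)

Section MatroidRank.
Variables (R : realType) (T : finType) (M : valuated_matroid R T).
Implicit Types (B C D F X Y Z : {set T}).
Local Notation rk := (Defs.rk M).
Local Notation G := (ground M).
Local Notation basis := (Defs.basis M).
Local Notation flat := (Defs.flat M).

Lemma basis_ground B : basis B -> B \subset G.
Proof. by move=> /nu_support[]. Qed.

Lemma card_basis B : basis B -> #|B| = vrank M.
Proof. by move=> /nu_support[]. Qed.

Lemma exists_basis : exists B, basis B.
Proof. exact: nu_nontrivial. Qed.

(** For two bases the right-hand side of [nu_exchange] is finite, so both terms on the left are
    finite; only the first exchanged set is recorded. *)
Lemma basis_exchange B C a : basis B -> basis C -> a \in B :\: C ->
  exists2 b, b \in C :\: B & basis (b |: (B :\ a)).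
Proof.
move=> bB bC aBC.
have [b bCB le_nu] := nu_exchange (basis_ground bB) (card_basis bB)
  (basis_ground bC) (card_basis bC) aBC.
exists b => //; apply/eqP => nuy; move: le_nu.
rewrite nuy addye ?nu_neq_ninfty // leye_eq; apply/negP.
by rewrite adde_Neq_pinfty ?nu_neq_ninfty //; apply/andP.
Qed.

Lemma card_basis_setI B X : basis B -> #|B :&: X| <= rk X.
Proof. by move=> bB; apply: (@leq_bigmax_cond _ basis (fun B => #|B :&: X|)). Qed.

Lemma rk_attained X : exists2 B, basis B & #|B :&: X| = rk X.
Proof.
have [B bB] := exists_basis.
have [|B' bB' e] := @eq_bigmax_cond _ basis (fun B => #|B :&: X|).
  by apply/card_gt0P; exists B.
by exists B'; rewrite // /Defs.rk e.
Qed.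

Lemma rk_le X k : (forall B, basis B -> #|B :&: X| <= k) -> rk X <= k.
Proof. by move=> ub; have [B /ub le_k <-] := rk_attained X. Qed.

(** As long as [B] meets [Y] in fewer elements than [C] does, some element of [B] outside both [Y]
    and [C] can be exchanged for one of [C]. The trace of [B] on [Y] never loses an element, and
    [B :\: C] shrinks. *)
Lemma basis_augment B C Y : basis B -> basis C ->
  exists2 B', basis B' & B :&: Y \subset B' /\ #|C :&: Y| <= #|B' :&: Y|.
Proof.
elim/ltn_ind: {B}_.+1 {-2}B (ltnSn #|B :\: C|) => // k IH B ltBk bB bC.
have [leCB|ltBC] := leqP #|C :&: Y| #|B :&: Y|.
  by exists B; rewrite ?subsetIl.
(* Bases have equal size, so a smaller trace on [Y] means a larger part outside [Y]. *)
have /subsetPn[a] : ~~ (B :\: Y \subset C :\: Y).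
  apply/negP => /subset_leq_card.
  have := cardsID Y B; have := cardsID Y C.
  rewrite (card_basis bB) (card_basis bC); lia.
rewrite !inE => /andP[aY aB]; rewrite aY /= => aC.
have aBC : a \in B :\: C by rewrite inE aC.
have [b bCB bas] := basis_exchange bB bC aBC.
have lt1 : #|(b |: (B :\ a)) :\: C| < #|B :\: C|.
  rewrite (cardsD1 a (B :\: C)) aBC add1n ltnS subset_leq_card //.
  apply/subsetP => z; rewrite !inE => /andP[zC /predU1P[zb|/andP[-> ->]]].
    by move: bCB; rewrite -zb inE (negbTE zC) andbF.
  by rewrite zC.
have [B' bB' [sB' leC]] := IH _ ltBk _ lt1 bas bC.
exists B' => //; split=> //; apply: subset_trans sB'.
apply/subsetP => z; rewrite !inE => /andP[zB zY]; rewrite zB zY !andbT.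
by apply/orP; right; apply: contraNneq aY => <-.
Qed.

(** Exchange moves [B] towards [C] outside [Y] without touching [B :&: Y], until the parts outside
    [Y] coincide. This is what makes the ranks of minors independent of the chosen adapted basis. *)
Lemma basis_glue B C Y : basis B -> basis C ->
  #|B :&: Y| = rk Y -> #|C :&: Y| = rk Y -> basis (B :&: Y :|: C :\: Y).
Proof.
elim/ltn_ind: {B}_.+1 {-2}B (ltnSn #|B :\: C|) => // k IH B ltBk bB bC rB rC.
have [sBC|/subsetPn[a]] := boolP (B :\: Y \subset C :\: Y).
  suff <- : B :\: Y = C :\: Y by rewrite setID.
  apply/eqP; rewrite eqEcard sBC /=.
  have := cardsID Y B; have := cardsID Y C.
  rewrite (card_basis bB) (card_basis bC); lia.
rewrite !inE => /andP[aY aB]; rewrite aY /= => aC.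
have aBC : a \in B :\: C by rewrite inE aC.
have [b bCB bas] := basis_exchange bB bC aBC.
have lt1 : #|(b |: (B :\ a)) :\: C| < #|B :\: C|.
  rewrite (cardsD1 a (B :\: C)) aBC add1n ltnS subset_leq_card //.
  apply/subsetP => z; rewrite !inE => /andP[zC /predU1P[zb|/andP[-> ->]]].
    by move: bCB; rewrite -zb inE (negbTE zC) andbF.
  by rewrite zC.
have sBY : B :&: Y \subset (b |: (B :\ a)) :&: Y.
  apply/subsetP => z; rewrite !inE => /andP[zB zY]; rewrite zB zY !andbT.
  by apply/orP; right; apply: contraNneq aY => <-.
(* The trace on [Y] already has maximal size, so the new element [b] cannot lie in [Y]. *)
have eBY : B :&: Y = (b |: (B :\ a)) :&: Y.
  by apply/eqP; rewrite eqEcard sBY rB card_basis_setI.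
rewrite eBY; apply: (IH _ ltBk _ lt1 bas bC _ rC).
by rewrite -eBY.
Qed.

(** A basis attaining the rank of [X] is augmented inside [Y]. Having one basis for both ranks turns
    submodularity into a count of elements. *)
Lemma rk_attained2 X Y : X \subset Y ->
  exists2 B, basis B & #|B :&: X| = rk X /\ #|B :&: Y| = rk Y.
Proof.
move=> sXY; have [B bB rB] := rk_attained X; have [C bC rC] := rk_attained Y.
have [B' bB' [sB' leC]] := basis_augment Y bB bC.
exists B' => //; split; apply/eqP; rewrite eqn_leq card_basis_setI //=.
  rewrite -rB subset_leq_card // subsetI subsetIr andbT.
  by apply: subset_trans sB'; apply: setIS.
by rewrite -rC.
Qed.

Lemma rkS X Y : X \subset Y -> rk X <= rk Y.
Proof.
move=> sXY; have [B bB <-] := rk_attained X.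
by apply: leq_trans (card_basis_setI _ bB); rewrite subset_leq_card // setIS.
Qed.

Lemma rk0 : rk set0 = 0.
Proof. by apply/eqP; rewrite -leqn0; apply: rk_le => B _; rewrite setI0 cards0. Qed.

Lemma rk_ground : rk G = vrank M.
Proof.
have [B bB <-] := rk_attained G.
by rewrite (setIidPl (basis_ground bB)) card_basis.
Qed.

Lemma rk_submodular X Y : rk (X :|: Y) + rk (X :&: Y) <= rk X + rk Y.
Proof.
have sIU : X :&: Y \subset X :|: Y by apply: subset_trans (subsetIl _ _) (subsetUl _ _).
have [B bB [<- <-]] := rk_attained2 sIU.
have := cardsUI (B :&: X) (B :&: Y).
rewrite -setIUr setIACA setIid => ->.
by apply: leq_add; apply: card_basis_setI.
Qed.

(** Submodularity for [Y] and [X :|: Z], whose intersection contains [X]. *)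
Lemma rk_absorb X Y Z : X \subset Y -> rk (X :|: Z) = rk X -> rk (Y :|: Z) = rk Y.
Proof.
move=> sXY eX; apply/eqP; rewrite eqn_leq [rk Y <= _]rkS ?subsetUl // andbT.
have := rk_submodular Y (X :|: Z); rewrite setUA (setUidPl sXY) eX.
have : rk X <= rk (Y :&: (X :|: Z)) by rewrite rkS // subsetI sXY subsetUl.
lia.
Qed.

Lemma rk_absorb_sub X Y Z :
  (forall e, e \in Z -> rk (e |: X) = rk X) -> X \subset Y -> Y \subset X :|: Z ->
  rk Y = rk X.
Proof.
move=> absorb sXY sYXZ.
suff {Y sXY sYXZ} eXZ : rk (X :|: Z) = rk X.
  by apply/eqP; rewrite eqn_leq [_ <= rk Y]rkS // -eXZ rkS.
elim: {Z}#|_| {-2}Z (erefl #|Z|) absorb => [|k IH] Z.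
  by move=> /eqP; rewrite cards_eq0 => /eqP ->; rewrite setU0.
move=> cZ absorb; have /card_gt0P[e eZ] : 0 < #|Z| by rewrite cZ.
have IHe : rk (X :|: Z :\ e) = rk X.
  apply: IH => [|f]; first by move: cZ; rewrite (cardsD1 e) eZ => -[].
  by rewrite inE => /andP[_ /absorb].
rewrite -(setD1K eZ) setUCA setUC -IHe; apply: (@rk_absorb X); rewrite ?subsetUl //.
by rewrite setUC absorb.
Qed.

(** * Flats, closures and joins *)

Lemma flat_ground F : flat F -> F \subset G.
Proof. by case/andP. Qed.

Lemma flat_rk_lt F e : flat F -> e \in G -> e \notin F -> rk F < rk (e |: F).
Proof. by case/andP=> _ /forall_inP lt eG eF; apply: lt; rewrite inE eF. Qed.

Lemma flatP F : reflect (F \subset G /\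
    forall e, e \in G -> rk (e |: F) = rk F -> e \in F) (flat F).
Proof.
apply: (iffP andP) => -[sF lt]; split=> //.
  move=> e eG er; apply: contraPT er => eF.
  by have /forall_inP/(_ e) := lt; rewrite inE eF eG => /(_ isT); lia.
apply/forall_inP => e; rewrite inE => /andP[eF eG].
by rewrite ltn_neqAle rkS ?subsetUr // andbT; apply: contraNneq eF => /esym/lt ->.
Qed.

Lemma flat_absorb F X e : flat F -> X \subset F -> e \in G ->
  rk (e |: X) = rk X -> e \in F.
Proof.
move=> /flatP[_ clF] sXF eG er; apply: clF eG _.
by rewrite setUC; apply: rk_absorb sXF _; rewrite setUC.
Qed.

Lemma flatI F F' : flat F -> flat F' -> flat (F :&: F').
Proof.
move=> fF fF'; apply/flatP; split=> [|e eG er].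
  exact: subset_trans (subsetIl _ _) (flat_ground fF).
by rewrite inE (flat_absorb fF _ eG er) ?subsetIl // (flat_absorb fF' _ eG er) ?subsetIr.
Qed.

Lemma flatG : flat G.
Proof. by apply/flatP; split. Qed.

Lemma flat_proper_rk F F' : flat F -> flat F' -> F \proper F' -> rk F < rk F'.
Proof.
move=> fF fF' /properP[sFF' [e eF' eF]].
have eG := subsetP (flat_ground fF') _ eF'.
by apply: leq_trans (flat_rk_lt fF eG eF) _; rewrite rkS // subUset sub1set eF'.
Qed.

(** Elementwise form of the smallest flat above [X]; ranks of joins, which are defined as
    intersections of flats, are computed through it. *)
Definition closure X := [set e in G | rk (e |: X) == rk X].

Lemma sub_closure X : X \subset G -> X \subset closure X.
Proof.
move=> sXG; apply/subsetP => e eX; rewrite inE (subsetP sXG) //=.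
by rewrite (setUidPr _) // sub1set.
Qed.

Lemma rk_closure X Y : X \subset G -> X \subset Y -> Y \subset closure X -> rk Y = rk X.
Proof.
move=> sXG sXY sYc; apply: (@rk_absorb_sub _ _ (closure X)) => // [e|].
  by rewrite inE => /andP[_ /eqP].
by rewrite (subset_trans sYc) ?subsetUr.
Qed.

Lemma flat_closure X : X \subset G -> flat (closure X).
Proof.
move=> sXG; have sXc := sub_closure sXG.
apply/flatP; split=> [|e eG er]; first by apply/subsetP => e; rewrite inE => /andP[].
rewrite inE eG eqn_leq [rk X <= _]rkS ?subsetUr // andbT.
by rewrite -(rk_closure sXG sXc) // -er rkS // setUS.
Qed.

Lemma closure_min X F : flat F -> X \subset F -> closure X \subset F.
Proof.
move=> fF sXF; apply/subsetP => e; rewrite inE => /andP[eG /eqP].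
exact: flat_absorb.
Qed.

Lemma join_closure F F' : flat F -> flat F' -> join M F F' = closure (F :|: F').
Proof.
move=> fF fF'.
have sG : F :|: F' \subset G by rewrite subUset !flat_ground.
apply/eqP; rewrite eqEsubset; apply/andP; split.
  by apply: bigcap_inf; rewrite flat_closure // sub_closure.
by apply/bigcapsP => F2 /andP[fF2 sF2]; apply: closure_min.
Qed.

Section Join.
Variables (F F' : {set T}).
Hypotheses (fF : flat F) (fF' : flat F').

Let sG : F :|: F' \subset G. Proof. by rewrite subUset !flat_ground. Qed.

Lemma flat_join : flat (join M F F').
Proof. by rewrite join_closure // flat_closure. Qed.

Lemma sub_join : F :|: F' \subset join M F F'.
Proof. by rewrite join_closure // sub_closure. Qed.

Lemma join_min F2 : flat F2 -> F :|: F' \subset F2 -> join M F F' \subset F2.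
Proof. by move=> fF2 sF2; rewrite join_closure // closure_min. Qed.

Lemma rk_join_sub X : F :|: F' \subset X -> X \subset join M F F' ->
  rk X = rk (F :|: F').
Proof. by move=> sX; rewrite join_closure // => /(rk_closure sG sX). Qed.

Lemma modular_rk : modular_flat M F ->
  rk (F :|: F') + rk (F :&: F') = rk F + rk F'.
Proof. by move=> [_ /(_ F' fF') <-]; rewrite (rk_join_sub sub_join). Qed.

End Join.

(* The modular law [(E /\ F') \/ F) /\ y = (E /\ y) \/ F], on the level of
   ranks. *)
Lemma modular_rk_join Ei F F' y :
    modular_flat M Ei -> flat F -> flat F' -> flat y ->
    F \subset y -> y \subset F' ->
  rk (join M (Ei :&: F') F :&: y) + rk (Ei :&: F) = rk (Ei :&: y) + rk F.
Proof.
move=> mE fF fF' fy sFy syF'; have fE := mE.1.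
have fEF' := flatI fE fF'.
set z := _ :&: y; have fz : flat z by rewrite flatI ?flat_join.
have sz : Ei :&: F' :|: F \subset join M (Ei :&: F') F by rewrite sub_join.
have sFz : F \subset z by rewrite subsetI sFy (subset_trans (subsetUr _ _) sz).
(* [z] has the same meet with [Ei] as [y], and its union with [Ei] has the rank of [Ei :|: F]. The
   claim is then the difference of the modularity identities of [Ei] with [z] and with [F]. *)
have eEz : Ei :&: z = Ei :&: y.
  apply/eqP; rewrite eqEsubset setIS ?subsetIr //= subsetI subsetIl /=.
  rewrite subsetI subsetIr andbT; apply: subset_trans sz.
  by apply: subset_trans (subsetUl _ _); apply: setIS.
have rz : rk (Ei :|: z) = rk (Ei :|: F).
  apply: (rk_join_sub fE fF); first exact: setUS.
  have sj := sub_join fE fF.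
  rewrite subUset (subset_trans (subsetUl _ _) sj) /=.
  apply: subset_trans (subsetIl _ _) _; apply: join_min => //; first exact: flat_join.
  by apply: subset_trans sj; rewrite setSU ?subsetIl.
have := modular_rk fE fz mE; have := modular_rk fE fF mE; rewrite rz eEz; lia.
Qed.

End MatroidRank.

Lemma setDUK (T : finType) (X Y : {set T}) : X \subset Y -> Y :\: X :|: X = Y.
Proof. by move=> sXY; rewrite setUC -{1}(setIidPr sXY) setID. Qed.

(** * Minors *)

Section Minors.
Variables (R : realType) (T : finType).
Implicit Types (M : valuated_matroid R T) (B D F X Y Z : {set T}).

Lemma card_adapted_basis M F : #|adapted_basis M F :&: F| = rk M F.
Proof.
apply/eqP; rewrite eqn_leq card_basis_setI ?adapted_basisP //=.
apply: rk_le => B bB; rewrite /adapted_basis; case: arg_maxnP => [|C _]; last exact.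
exact: (xchooseP (nu_nontrivial M)).
Qed.

Lemma basis_minor M D B0 (bB0 : Defs.basis M B0) B :
  Defs.basis (minor D bB0) B = (B \subset D) && Defs.basis M (B :|: B0 :\: D).
Proof. by rewrite /Defs.basis /= /minor_nu; case: ifP; rewrite ?eqxx. Qed.

Lemma rk_restriction M F X : rk (restriction M F) X = rk M (X :&: F).
Proof.
have eF := card_adapted_basis M F; have bF := adapted_basisP M F.
apply/eqP; rewrite eqn_leq; apply/andP; split; apply: rk_le.
  move=> B; rewrite basis_minor => /andP[sBF bB].
  apply: leq_trans (card_basis_setI _ bB); rewrite subset_leq_card //.
  apply/subsetP => z; rewrite !inE => /andP[zB ->].
  by rewrite zB (subsetP sBF).
have [C bC [rX rF]] := rk_attained2 M (subsetIr X F).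
move=> B bB; apply: leq_trans (card_basis_setI _ bB) _.
(* The trace of [C] on [F] is glued to the complement fixed in the definition of the restriction. *)
have bCF : Defs.basis (restriction M F) (C :&: F).
  by rewrite basis_minor subsetIr basis_glue.
by rewrite -rX [X :&: F]setIC setIA (card_basis_setI _ bCF).
Qed.

(** The additive form avoids truncated subtraction. A basis of the contraction completes the fixed
    basis of [F]; conversely, by gluing, any basis adapted to [F] has its part outside [F] as a
    basis of the contraction. *)
Lemma rk_contraction M F X : (rk (contraction M F) X + rk M F = rk M (X :|: F))%N.
Proof.
have eF := card_adapted_basis M F; have bF := adapted_basisP M F.
apply/eqP; rewrite eqn_leq; apply/andP; split.
  have [B] := rk_attained (contraction M F) X.
  rewrite basis_minor -eF => /andP[sBF bB] <-.
  rewrite -[X in (_ + X <= _)%N](_ : #|adapted_basis M F :\: ~: F| = _); last first.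
    by rewrite setDE setCK.
  have dB : B :&: X :&: (adapted_basis M F :\: ~: F) = set0.
    apply/setP => z; rewrite !inE negbK; apply/negbTE.
    by apply/negP => /and3P[/andP[/(subsetP sBF)]]; rewrite inE => /negbTE ->.
  rewrite -cardsUI dB cards0 addn0.
  apply: leq_trans (card_basis_setI _ bB); rewrite subset_leq_card //.
  apply/subsetP => z; rewrite !inE negbK.
  by case/orP=> [/andP[-> ->]|/andP[-> ->]]; rewrite ?orbT.
have [C bC [rF rX]] := rk_attained2 M (subsetUr X F).
have bCF : Defs.basis (contraction M F) (C :\: F).
  rewrite basis_minor setDE subsetIr setUC [_ :\: ~: F]setDE setCK -setDE.
  exact: basis_glue.
have := card_basis_setI X bCF; rewrite -rX -rF.
have -> : C :&: (X :|: F) = ((C :\: F) :&: X) :|: (C :&: F).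
  by apply/setP => z; rewrite !inE; case: (z \in C); case: (z \in F); case: (z \in X).
have := (leq_card_setU ((C :\: F) :&: X) (C :&: F)).1; lia.
Qed.

Lemma vrank_rk_ground M : vrank M = rk M (ground M).
Proof. by rewrite rk_ground. Qed.

Section Interval.
Variables (M : valuated_matroid R T) (F F' : {set T}).
Hypotheses (fF : flat M F) (fF' : flat M F') (sFF' : F \subset F').
Let Q := contraction (restriction M F') F.

Lemma rk_interval X : X \subset F' -> (rk Q X + rk M F = rk M (X :|: F))%N.
Proof.
move=> sX; have := rk_contraction (restriction M F') F X.
by rewrite !rk_restriction (setIidPl sFF') (setIidPl _) // subUset sX.
Qed.

Lemma ground_interval : ground Q = F' :\: F.
Proof. by rewrite /= (setIidPr (flat_ground fF')) setDE. Qed.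

Lemma vrank_interval : (vrank Q + rk M F = rk M F')%N.
Proof.
by rewrite vrank_rk_ground ground_interval rk_interval ?subsetDl // setDUK.
Qed.

(** Ranks over [F] differ from those in [M] by the constant [rk M F], so the closure conditions
    agree on [F' :\: F]. Elements of [F] lie in [Y] anyway, and those outside [F'] raise the rank
    because [F'] is flat. *)
Lemma flat_interval Y : F \subset Y -> Y \subset F' ->
  Defs.flat Q (Y :\: F) = Defs.flat M Y.
Proof.
move=> sFY sYF'.
have rkY (Z : {set T}) : Z \subset F' -> F \subset Z -> (rk Q (Z :\: F) + rk M F = rk M Z)%N.
  move=> sZ sFZ; rewrite rk_interval ?(subset_trans (subsetDl _ _)) //.
  by rewrite setDUK.
have addD e : e \notin F -> e |: (Y :\: F) = (e |: Y) :\: F.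
  move=> eF; apply/setP => z; rewrite !inE.
  by case: eqVneq => [->|] //=; rewrite eF.
have rkeY e : e \in F' -> e \notin F ->
    (rk Q (e |: (Y :\: F)) == rk Q (Y :\: F)) = (rk M (e |: Y) == rk M Y).
  move=> eF' eF; rewrite addD // -(eqn_add2r (rk M F)) !rkY //.
    by rewrite subUset sub1set eF'.
  exact: subset_trans sFY (subsetUr _ _).
apply/flatP/flatP; rewrite ground_interval => -[sY clY]; split.
- exact: subset_trans sYF' (flat_ground fF').
- move=> e eG er; have [eF|eF] := boolP (e \in F); first exact: (subsetP sFY).
  have eF' := flat_absorb fF' sYF' eG er.
  have : e \in Y :\: F by apply: clY; rewrite ?inE ?eF //; apply/eqP; rewrite rkeY ?er.
  by rewrite inE => /andP[].
- exact: setSD.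
- move=> e; rewrite !inE => /andP[eF eF'] /eqP; rewrite rkeY // eF => /eqP.
  exact/clY/(subsetP (flat_ground fF')).
Qed.

End Interval.
End Minors.

Local Open Scope ring_scope.

(** * Intersection numbers of an ample divisor *)

Lemma set_enum_injection n s (tau : {set 'I_s}) : #|tau| = n ->
  exists2 f : 'I_n -> 'I_s, injective f & tau = [set f k | k : 'I_n].
Proof.
move=> <-; exists enum_val; first exact: enum_val_inj.
apply/setP => i; apply/idP/imsetP => [i_tau|[k _ ->]]; last exact: enum_valP.
by exists (enum_rank_in i_tau i); rewrite ?enum_rankK_in.
Qed.

Section Intersection.
Variables (R : realType) (n s : nat) (Sigma : simplicial_fan R n s).
Variables (d : chow_degree Sigma) (H : 'I_s -> int).
Hypothesis ample_H : ample Sigma H.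

(* Induction on k: if m is the Cartier datum of H on a maximal cone containing
   tau, then H is equivalent to \sum_i (H_i + <m, u_i>) D_i, whose coefficients
   are nonnegative and vanish for the rays of tau. *)
Lemma ample_orbit_degree_ge0 k (tau : {set 'I_s}) :
    tau \in cones Sigma -> (#|tau| + k)%N = n ->
  0 <= d (\prod_(i in tau) 'X_i * (\sum_(j < s) (H j)%:~R *: 'X_j) ^+ k).
Proof.
set L := \sum_(j < s) _; elim: k tau => [|k IH] tau tauS.
  rewrite addn0 expr0 mulr1 => /set_enum_injection[f injf tauE].
  rewrite {1}tauE big_imset /=; last by move=> ? ? _ _; apply: injf.
  by rewrite chow_deg_cone -?tauE // invr_ge0 ler0z normr_ge0.
move=> card_tau; have [sigma maxS sub_tau] := maxset_exists tauS.
have [m [m_in m_out]] := ample_H maxS.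
pose b i := (H i + pairing m (ray Sigma i))%:~R : rat.
have eL : L = \sum_(i < s) b i *: 'X_i
            - \sum_(i < s) (pairing m (ray Sigma i))%:~R *: 'X_i.
  by rewrite -sumrB; apply: eq_bigr => i _; rewrite -scalerBl -intrB addrK.
(* Only one of the [k.+1] factors is replaced; the remaining power of [L] feeds the induction. *)
rewrite exprSr mulrA {2}eL mulrBr linearB /= chow_deg_principal subr0.
rewrite mulr_sumr linear_sum sumr_ge0 // => i _.
rewrite -scalerAr linearZ /=.
(* For a ray in [sigma] the coefficient vanishes. Otherwise it is positive, and [i |: tau] is either
   a cone with one more ray, handled by induction, or a nonface, where the degree is zero. *)
have [i_sigma|i_sigma] := boolP (i \in sigma).
  by rewrite /b m_in // subrr mul0r.
apply: mulr_ge0; first by rewrite ler0z -lerBlDl sub0r ltW // m_out.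
have i_tau : i \notin tau by apply: contra i_sigma => /(subsetP sub_tau).
have -> : \prod_(j in tau) 'X_j * L ^+ k * 'X_i
        = \prod_(j in i |: tau) 'X_j * L ^+ k :> {mpoly rat[s]}.
  by rewrite big_setU1 //= mulrAC [_ * 'X_i]mulrC.
have [face|nonface] := boolP (i |: tau \in cones Sigma).
  by apply: IH; rewrite // cardsU1 i_tau -card_tau; lia.
by rewrite mulrC chow_deg_nonface.
Qed.

Lemma curve_degree_ge0 i : 0 <= curve_degree d H i.
Proof.
(* In dimension zero a ray would be twice itself, against primitivity; hence [1 + n.-1] is [n]. *)
have n_gt0 : (0 < n)%N.
  rewrite lt0n; apply/eqP => n0.
  have ray0 : ray Sigma i = 2 *: ray Sigma i.
    by apply/rowP => k; have := ltn_ord k; rewrite {2}n0.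
  by have := ray_primitive ray0.
have := @ample_orbit_degree_ge0 n.-1 [set i] (cones_ray Sigma i).
by rewrite big_set1; apply; rewrite cards1 add1n prednK.
Qed.

End Intersection.

(** * Degrees of subsheaves and quotients *)

Lemma fsbig_int_interval (f : int -> rat) (lo : int) (m : nat) :
    (forall j, j < lo -> f j = 0) -> (forall j, lo + m%:Z <= j -> f j = 0) ->
  \sum_(j \in [set: int]%classic) f j = \sum_(k < m) f (lo + k%:Z).
Proof.
move=> f_lo f_hi; pose r := [seq lo + k%:Z | k <- iota 0 m].
have ur : uniq r by rewrite map_inj_uniq ?iota_uniq // => k l; lia.
rewrite -(fsbig_widen [set` r]%classic) //; last first.
  move=> j [_ /= jr]; have [/f_lo //|lo_j] := ltP j lo.
  apply: f_hi; rewrite leNgt; apply/negP => j_hi; apply: jr.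
  by apply/mapP; exists `|j - lo|%N; [rewrite mem_iota|]; lia.
by rewrite -fsbig_seq // big_map -{1}[m]subn0 -/(index_iota 0 m) big_mkord.
Qed.

(** Summation by parts: the degree becomes linear in the ranks of the filtration steps, so rank
    identities and inequalities transfer to it term by term. *)
Lemma sum_jumps (g : int -> rat) (c : rat) (lo : int) (m : nat) :
    (forall j, j <= lo -> g j = c) -> (forall j, lo + m%:Z <= j -> g j = 0) ->
  \sum_(j \in [set: int]%classic) j%:~R * (g j - g (j + 1)) =
    lo%:~R * c + \sum_(k < m) g (lo + k.+1%:Z).
Proof.
move=> g_lo g_hi; rewrite (@fsbig_int_interval _ lo m); first last.
- by move=> j hi_j; rewrite !g_hi ?subrr ?mulr0 //; lia.
- by move=> j j_lo; rewrite !g_lo ?subrr ?mulr0 //; lia.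
have {g_hi} g_m : g (lo + m%:Z) = 0 by apply: g_hi.
have {g_lo} <- : g lo = c by apply: g_lo.
(* Keeping the boundary term makes the identity valid for every [m], without vanishing at the upper
   end, so that induction applies. *)
suff : \sum_(k < m) (lo + k%:Z)%:~R * (g (lo + k%:Z) - g (lo + k%:Z + 1)) +
    (lo + m%:Z)%:~R * g (lo + m%:Z) =
    lo%:~R * g lo + \sum_(k < m) g (lo + k.+1%:Z).
  by rewrite g_m mulr0 addr0.
elim: m {g_m} => [|m IH]; first by rewrite !big_ord0 add0r !addr0.
rewrite !big_ord_recr /= addrA -IH.
have -> : lo + m%:Z + 1 = lo + m.+1%:Z by lia.
have -> : (lo + m.+1%:Z)%:~R = (lo + m%:Z)%:~R + 1 :> rat.
  by rewrite (_ : lo + m.+1%:Z = lo + m%:Z + 1) ?intrD //; lia.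
ring.
Qed.

Section SheafDegree.
Variables (R : realType) (T : finType) (s : nat) (h : 'I_s -> rat).

Lemma sheaf_degree_Abel (Q : sheaf_data R T s) (c : nat) (lo : int) (m : nat) :
    (forall i (j : int), j <= lo -> rk (vmat Q) (filt Q i j) = c) ->
    (forall i (j : int), lo + m%:Z <= j -> rk (vmat Q) (filt Q i j) = 0%N) ->
  sheaf_degree h Q = \sum_(i < s) (lo%:~R * c%:R +
    \sum_(k < m) (rk (vmat Q) (filt Q i (lo + k.+1%:Z)))%:R) * h i.
Proof.
move=> rk_lo rk_hi; apply: eq_bigr => i _; congr (_ * _).
by apply: (sum_jumps (g := fun j => (rk (vmat Q) (filt Q i j))%:R)) => j /=
  => [/rk_lo ->|/rk_hi ->].
Qed.

Variables (E : sheaf_data R T s) (lo : int) (m : nat).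
Hypothesis filt_lo : forall i (j : int), j <= lo -> filt E i j = ground (vmat E).
Hypothesis filt_hi : forall i (j : int), lo + m%:Z <= j -> filt E i j = set0.
Hypothesis modular_E : forall i j, modular_flat (vmat E) (filt E i j).
Local Notation M := (vmat E).
Local Notation rk := (Defs.rk M).
Implicit Types (F x y : {set T}).

Definition flat_degree y := sheaf_degree h (subsheaf E y).

Lemma flat_degreeE y : y \subset ground M ->
  flat_degree y = \sum_(i < s) (lo%:~R * (rk y)%:R +
    \sum_(k < m) (rk (filt E i (lo + k.+1%:Z) :&: y))%:R) * h i.
Proof.
move=> syG; have eR X : Defs.rk (restriction M y) (X :&: y) = rk (X :&: y).
  by rewrite rk_restriction -setIA setIid.
rewrite /flat_degree (@sheaf_degree_Abel _ (rk y) lo m) /=.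
- by apply: eq_bigr => i _; congr ((_ + _) * _); apply: eq_bigr => k _; rewrite eR.
- by move=> i j /filt_lo ->; rewrite eR (setIidPr syG).
- by move=> i j /filt_hi ->; rewrite eR set0I rk0.
Qed.

(** [Q] is arbitrary so that the formula serves both the quotient over [F] and the subsheaves of
    that quotient. *)
Lemma sheaf_degree_interval (Q : sheaf_data R T s) F y :
    F \subset y -> y \subset ground M ->
    (forall i j, (Defs.rk (vmat Q) (filt Q i j) + rk (filt E i j :&: F))%N
               = rk (filt E i j :&: y)) ->
  sheaf_degree h Q = flat_degree y - flat_degree F.
Proof.
move=> sFy syG rkQ; have sFG := subset_trans sFy syG.
rewrite (@sheaf_degree_Abel _ (rk y - rk F)%N lo m).
- rewrite !flat_degreeE // -sumrB; apply: eq_bigr => i _.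
  rewrite -mulrBl natrB ?rkS //; congr (_ * _).
  rewrite opprD addrACA -mulrBr -sumrB; congr (_ + _).
  by apply: eq_bigr => k _; rewrite -rkQ natrD addrK.
- move=> i j /filt_lo e; have := rkQ i j.
  by rewrite e (setIidPr sFG) (setIidPr syG) => <-; rewrite addnK.
- by move=> i j /filt_hi e; have := rkQ i j; rewrite e !set0I rk0 addn0.
Qed.

(** * Slopes and semistability of quotients *)

Section Interval.
Variables (F F' : {set T}).
Hypotheses (fF : flat M F) (fF' : flat M F') (sFF' : F \subset F').
Local Notation Q := (quotient E F' F).

(** This is where modularity of the [filt E i j] makes degrees additive: it is [modular_rk_join]
    read in the minor, and supplies the hypothesis of [sheaf_degree_interval]. *)
Lemma rk_filt_quotient i j y : flat M y -> F \subset y -> y \subset F' ->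
  (Defs.rk (vmat Q) (filt Q i j :&: (y :\: F)) + rk (filt E i j :&: F))%N
    = rk (filt E i j :&: y).
Proof.
move=> fy sFy syF'; have fE := (modular_E i j).1.
have := modular_rk_join (modular_E i j) fF fF' fy sFy syF'.
have := @rk_interval _ _ M F F' sFF' (filt Q i j :&: (y :\: F)).
have -> : (filt Q i j :&: (y :\: F)) :|: F = join M (filt E i j :&: F') F :&: y.
  rewrite -setDIl setDUK // subsetI sFy andbT.
  by apply: subset_trans (sub_join (flatI fE fF') fF); apply: subsetUr.
have -> : filt Q i j :&: (y :\: F) \subset F'.
  by rewrite (subset_trans (subsetIr _ _)) // (subset_trans (subsetDl _ _)).
rewrite /=; lia.
Qed.

Lemma quotient_degree : sheaf_degree h Q = flat_degree F' - flat_degree F.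
Proof.
apply: sheaf_degree_interval; rewrite ?flat_ground // => i j.
(* The case [y = F'], where intersecting with [F' :\: F] does not change the quotient filtration. *)
rewrite -(rk_filt_quotient i j fF') //=; congr (Defs.rk _ _ + _)%N.
apply/esym/setIidPl/setSD/join_min => //; first by rewrite flatI // (modular_E i j).1.
by rewrite subUset subsetIr.
Qed.

Lemma quotient_slope :
  slope h Q = (flat_degree F' - flat_degree F) / ((rk F')%:R - (rk F)%:R).
Proof.
rewrite /slope quotient_degree; congr (_ / _).
by rewrite -(vrank_interval fF' sFF') natrD addrK.
Qed.

Lemma sub_quotient_slope y : flat M y -> F \subset y -> y \subset F' ->
  slope h (subsheaf Q (y :\: F))
    = (flat_degree y - flat_degree F) / ((rk y)%:R - (rk F)%:R).
Proof.
move=> fy sFy syF'; rewrite /slope; congr (_ / _).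
  apply: sheaf_degree_interval; rewrite ?flat_ground // => i j.
  by rewrite rk_restriction -setIA setIid rk_filt_quotient.
rewrite vrank_rk_ground rk_restriction -setIA setIid.
rewrite [ground _]ground_interval // (setIidPr _) ?setSD //.
have := @rk_interval _ _ M F F' sFF' (y :\: F).
rewrite setDUK // (subset_trans (subsetDl _ _)) // => /(_ isT) <-.
by rewrite natrD addrK.
Qed.

Lemma semistable_quotient :
  semistable h Q <-> forall y, flat M y -> F \proper y -> y \proper F' ->
    (flat_degree y - flat_degree F) / ((rk y)%:R - (rk F)%:R)
      <= (flat_degree F' - flat_degree F) / ((rk F')%:R - (rk F)%:R).
Proof.
rewrite /semistable quotient_slope; split=> ss y fy.
  move=> pFy pyF'; have [sFy syF'] := (proper_sub pFy, proper_sub pyF').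
  rewrite -sub_quotient_slope //; apply: ss.
  - by rewrite [Defs.flat _ _]flat_interval.
  - by rewrite setD_eq0 proper_subn.
  - rewrite [ground _]ground_interval // properE setSD //=.
    apply: contra (proper_subn pyF') => sF'y.
    by rewrite -(setDUK sFF') -(setDUK sFy) setSU.
(* Conversely, a flat [y] of the quotient comes from the flat [y :|: F] of [M]. *)
have syQ : y \subset F' :\: F by rewrite -(ground_interval F fF') (flat_ground fy).
have ey : (y :|: F) :\: F = y.
  rewrite setDUl setDv setU0; apply/setDidPl; rewrite disjoints_subset.
  by apply: subset_trans syQ _; rewrite setDE subsetIr.
have sFy : F \subset y :|: F by rewrite subsetUr.
have syF' : y :|: F \subset F' by rewrite subUset sFF' (subset_trans syQ) ?subsetDl.
move=> y0 py.
have fyF : flat M (y :|: F) by rewrite -(flat_interval fF' sFF') // ey.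
rewrite -{1}ey sub_quotient_slope //; apply: ss => //.
  rewrite properE sFy; apply: contra y0 => syF.
  by rewrite -subset0 -ey setDUl setDv setU0 subDset setU0 (subset_trans (subsetUl _ F)).
rewrite properE syF'; move: py; rewrite [ground _]ground_interval // => /proper_subn.
by apply: contra => sF'y; rewrite -ey setSD.
Qed.

End Interval.

(** * Supermodularity of the degree against modular flats *)

Hypothesis h_ge0 : forall i, 0 <= h i.

(** Modularity of [Ei] trades each meet with [Ei] for a union, and modularity of [F] cancels the
    remaining ranks. What is left is submodularity for [Ei :|: x] and [Ei :|: F]. *)
Lemma modular_supermodular Ei F x :
    modular_flat M Ei -> modular_flat M F -> flat M x ->
  (rk (Ei :&: x) + rk (Ei :&: F) <=
     rk (Ei :&: join M F x) + rk (Ei :&: (x :&: F)))%N.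
Proof.
move=> mE mF fx; have [fE fF] := (mE.1, mF.1).
have fJ := flat_join fF fx; have sJ := sub_join fF fx.
have rJ : rk (join M F x) = rk (F :|: x) by rewrite (rk_join_sub fF fx).
have := modular_rk fE fx mE; have := modular_rk fE fF mE.
have := modular_rk fE fJ mE; have := modular_rk fE (flatI fx fF) mE.
have := modular_rk fF fx mF; rewrite [F :&: x]setIC.
have := rk_submodular M (Ei :|: x) (Ei :|: F).
rewrite -setUIr -setUUr [x :|: F]setUC.
have : rk (Ei :|: join M F x) = rk (Ei :|: (F :|: x)).
  have := @rk_absorb _ _ M (F :|: x) (Ei :|: (F :|: x)) (join M F x).
  by rewrite -(setUA Ei) (setUidPr sJ) => -> //; rewrite subsetUr.
rewrite rJ; lia.
Qed.

Lemma flat_degree_supermodular F x : modular_flat M F -> flat M x ->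
  flat_degree x + flat_degree F <= flat_degree (join M F x) + flat_degree (x :&: F).
Proof.
move=> mF fx; have fF := mF.1; have fJ := flat_join fF fx.
rewrite !flat_degreeE ?flat_ground ?flatI // -!big_split /=.
apply: ler_sum => i _; rewrite -!mulrDl ler_wpM2r // addrACA [leRHS]addrACA.
have rJ : rk (join M F x) = rk (F :|: x) by rewrite (rk_join_sub fF fx) ?sub_join.
(* The terms in [lo], whose sign is arbitrary, cancel exactly because [F] is modular. *)
rewrite -!mulrDr -!natrD rJ [x :&: F]setIC modular_rk // addnC lerD2l.
rewrite -!big_split ler_sum //= => k _.
by rewrite -!natrD ler_nat [F :&: x]setIC modular_supermodular.
Qed.

End SheafDegree.

(** * Harder-Narasimhan chains *)

Section HarderNarasimhanChains.
Variables (R : realType) (T : finType) (M : valuated_matroid R T).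
Variable deg : {set T} -> rat.
Implicit Types (A F x y : {set T}) (Fs : seq {set T}).
Local Notation flat := (Defs.flat M).
Local Notation r X := ((rk M X)%:R : rat).

Definition slope_between A F := (deg F - deg A) / (r F - r A).

Definition semistable_between A F := forall y, flat y -> A \proper y ->
  y \proper F -> slope_between A y <= slope_between A F.

(** The bottom [A] is arbitrary so that existence and uniqueness go by induction on the tail of the
    chain. *)
Fixpoint HN_chain A Fs : Prop :=
  if Fs is F :: Fs' then
    [/\ flat F, A \proper F, semistable_between A F, HN_chain F Fs'
      & if Fs' is F2 :: _ then slope_between F F2 < slope_between A F else True]
  else A = ground M.

Lemma rk_sub_gt0 A F : flat A -> flat F -> A \proper F -> 0 < r F - r A.
Proof. by move=> fA fF pAF; rewrite subr_gt0 ltr_nat flat_proper_rk. Qed.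

Lemma slope_between_le A F mu : flat A -> flat F -> A \proper F ->
  (slope_between A F <= mu) = (deg F - deg A <= mu * (r F - r A)).
Proof. by move=> fA fF pAF; rewrite ler_pdivrMr // rk_sub_gt0. Qed.

Lemma slope_betweenK A F : flat A -> flat F -> A \proper F ->
  deg F - deg A = slope_between A F * (r F - r A).
Proof. by move=> fA fF pAF; rewrite divfK // gt_eqF // rk_sub_gt0. Qed.

(* F maximizes the slope over A, and is of largest cardinality among the
   maximizers. *)
Lemma maximal_destabilizing A : flat A -> A != ground M ->
  exists F, [/\ flat F, A \proper F, semistable_between A F
    & forall F', flat F' -> F \proper F' -> slope_between F F' < slope_between A F].
Proof.
move=> fA neA; pose above F := flat F && (A \proper F).
have aboveG : above (ground M).
  by rewrite /above flatG properEneq neA flat_ground.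
have [F0 /andP[fF0 pF0] max_slope] := arg_maxP (slope_between A) aboveG.
have max0 y : flat y -> A \proper y -> slope_between A y <= slope_between A F0.
  by move=> fy pAy; apply: max_slope; rewrite /above fy.
pose optimal F := above F && (slope_between A F == slope_between A F0).
have opt0 : optimal F0 by rewrite /optimal /above fF0 pF0 eqxx.
have [F /andP[/andP[fF pF] /eqP sF] maxF] := arg_maxnP (fun F => #|F|) opt0.
exists F; split=> //.
  by move=> y fy pAy _; rewrite sF max0.
(* The slope of [F'] over [A] is a weighted mean of those of [F] over [A] and [F'] over [F]; were
   the latter not smaller, [F'] would be a larger maximizer. *)
move=> F' fF' pFF'; rewrite ltNge; apply/negP => le_slope.
have pAF' := proper_trans pF pFF'.
have : optimal F'.
  rewrite /optimal /above fF' pAF' /= eq_le max0 //= -sF.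
  have := le_slope; rewrite !ler_pdivlMr ?rk_sub_gt0 // -/(slope_between _ _).
  have := slope_betweenK fA fF pF; lra.
by move=> /maxF /=; rewrite leqNgt proper_card.
Qed.

Lemma HN_chain_exists A : flat A -> exists Fs, HN_chain A Fs.
Proof.
elim/ltn_ind: {A}_.+1 {-2}A (ltnSn (#|T| - #|A|)%N) => k IH A ltA fA.
have [->|neA] := eqVneq A (ground M); first by exists [::].
have [F [fF pF ssF destab]] := maximal_destabilizing fA neA.
have [|Fs chain] := IH _ ltA F _ fF.
  by have := proper_card pF; have := max_card F; lia.
exists (F :: Fs); split=> //.
by case: Fs chain => // F2 Fs [fF2 pF2 _ _ _]; apply: destab.
Qed.

(** Clearing denominators admits both ends, in particular [y = A], where the slope would divide by
    zero. *)
Lemma semistable_between_le A F y : flat A -> flat F -> A \proper F ->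
    semistable_between A F -> flat y -> A \subset y -> y \subset F ->
  deg y - deg A <= slope_between A F * (r y - r A).
Proof.
move=> fA fF pAF ssF fy sAy syF.
have [->|neA] := eqVneq y A; first by rewrite !subrr mulr0.
have [->|neF] := eqVneq y F; first by rewrite -slope_betweenK.
have pAy : A \proper y by rewrite properEneq eq_sym neA.
by rewrite -slope_between_le // ssF // properEneq neF.
Qed.

Hypothesis supermodular : forall F x, modular_flat M F -> flat x ->
  deg x + deg F <= deg (join M F x) + deg (x :&: F).

Lemma HN_chain_bound A F Fs x :
    flat A -> HN_chain A (F :: Fs) ->
    (forall F', F' \in F :: Fs -> modular_flat M F') -> flat x -> A \subset x ->
  deg x - deg A <= slope_between A F * (r x - r A) /\
  (~~ (x \subset F) -> deg x - deg A < slope_between A F * (r x - r A)).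
Proof.
elim: Fs A F x => [|F2 Fs IH] A F x fA [fF pAF ssF chain lt_slope] mFs fx sAx.
  have sxF : x \subset F by rewrite chain flat_ground.
  by rewrite sxF; split=> //; apply: semistable_between_le.
have [sxF|nsxF] := boolP (x \subset F).
  by split=> //; apply: semistable_between_le.
suff lt_x : deg x - deg A < slope_between A F * (r x - r A) by split; first exact: ltW.
have mF := mFs F (mem_head _ _); have fxF := flatI fx fF.
have fJ := flat_join fF fx; have sJ := sub_join fF fx.
(* The tail bounds the degree of the join over [F]. Supermodularity carries this to [x] over
   [x :&: F], where the rank gap is the same and positive, so the drop in slope makes it strict;
   semistability covers [x :&: F] over [A]. *)
have [|le_J _] := IH F F2 (join M F x) fF chain _ fJ (subset_trans (subsetUl _ _) sJ).
  by move=> F' F'Fs; apply: mFs; rewrite inE F'Fs orbT.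
have rJ : r (join M F x) + r (x :&: F) = r F + r x.
  by rewrite -!natrD (rk_join_sub fF fx) // [x :&: F]setIC modular_rk.
have eJ : r (join M F x) - r F = r x - r (x :&: F) by lra.
have gap : 0 < r x - r (x :&: F).
  by rewrite rk_sub_gt0 // properEneq subsetIl andbT; apply: contra nsxF => /eqP/setIidPl.
have lt_gap : slope_between F F2 * (r x - r (x :&: F))
            < slope_between A F * (r x - r (x :&: F)) by rewrite ltr_pM2r.
have le_xF : deg (x :&: F) - deg A <= slope_between A F * (r (x :&: F) - r A).
  by apply: semistable_between_le; rewrite ?subsetIr // subsetI sAx proper_sub.
have := supermodular mF fx; rewrite eJ in le_J; lra.
Qed.

Lemma HN_chain_unique A Fs Fs' : flat A -> HN_chain A Fs -> HN_chain A Fs' ->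
  (forall F, F \in Fs -> modular_flat M F) ->
  (forall F, F \in Fs' -> modular_flat M F) -> Fs = Fs'.
Proof.
elim: Fs A Fs' => [|F Fs IH] A [|F' Fs'] fA //.
- by move=> -> [fF' pF' _ _ _]; have := proper_subn pF'; rewrite flat_ground.
- by move=> [fF pF _ _ _] eA; have := proper_subn pF; rewrite eA flat_ground.
move=> ch ch' mFs mFs'.
have [[fF pF _ chF _] [fF' pF' _ chF' _]] := (ch, ch').
have [le1 lt1] := HN_chain_bound fA ch mFs fF' (proper_sub pF').
have [le2 lt2] := HN_chain_bound fA ch' mFs' fF (proper_sub pF).
(* Each chain bounds the first flat of the other, so the first slopes agree; the strict bounds then
   force each first flat into the other. *)
have e : slope_between A F = slope_between A F'.
  by apply/le_anti; rewrite !slope_between_le // le1 le2.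
have eF : F = F'.
  apply/eqP; rewrite eqEsubset; apply/andP; split; apply: contraT.
    by move=> /lt2; rewrite -e -slope_betweenK // ltxx.
  by move=> /lt1; rewrite e -slope_betweenK // ltxx.
rewrite eF in chF mFs *; congr (_ :: _); apply: IH chF chF' _ _ => // F2 F2s.
  by apply: mFs; rewrite inE F2s orbT.
by apply: mFs'; rewrite inE F2s orbT.
Qed.

End HarderNarasimhanChains.

(** * From filtrations of the sheaf to chains of flats *)

Section Translation.
Variables (R : realType) (T : finType) (s : nat) (h : 'I_s -> rat).
Variable E : sheaf_data R T s.
Local Notation M := (vmat E).
Variables (lo : int) (m : nat).
Hypothesis filt_lo : forall i (j : int), j <= lo -> filt E i j = ground M.
Hypothesis filt_hi : forall i (j : int), lo + m%:Z <= j -> filt E i j = set0.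
Hypothesis modular_E : forall i j, modular_flat M (filt E i j).

Let gr A Fs i := quotient E (nth set0 (A :: Fs) i.+1) (nth set0 (A :: Fs) i).

(** Turns the conditions indexed by position into the recursive ones; [gr] generalizes [graded] to
    any bottom [A], since dropping the first flat shifts every index by one. *)
Lemma HN_chainP A Fs : flat M A ->
  [/\ forall F, F \in A :: Fs -> flat M F,
      path (fun B C : {set T} => B \proper C) A Fs,
      last A Fs = ground M,
      forall i, (i < size Fs)%N -> semistable h (gr A Fs i)
    & forall i, (i.+1 < size Fs)%N ->
        slope h (gr A Fs i.+1) < slope h (gr A Fs i)]
  <-> HN_chain M (flat_degree h E) A Fs.
Proof.
elim: Fs A => [|F Fs IH] A fA /=.
  by split=> [[]|->] //; split=> // F; rewrite inE => /eqP ->; apply: flatG.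
have slopeE := quotient_slope h filt_lo filt_hi modular_E.
have semiE := semistable_quotient h filt_lo filt_hi modular_E.
split.
  move=> [flats /andP[pAF pFs] lastG ss dec].
  have fF : flat M F by apply: flats; rewrite inE mem_head orbT.
  split=> //.
  - by apply/semiE => //; [exact: proper_sub|exact: (ss 0%N)].
  - apply/IH => //; split=> //.
    + by move=> F2 F2s; apply: flats; rewrite inE F2s orbT.
    + by move=> i; apply: (ss i.+1).
    + by move=> i; apply: (dec i.+1).
  - case: Fs {IH ss} flats pFs lastG dec => //= F2 Fs flats /andP[pFF2 _] _ dec.
    have fF2 : flat M F2 by apply: flats; rewrite !inE eqxx !orbT.
    by have := dec 0%N isT; rewrite /gr /= !slopeE // proper_sub.
move=> [fF pAF ssF /(IH _ fF)[flats pFs lastG ss dec] lt_slope].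
split=> //.
- by move=> F2; rewrite inE => /predU1P[->|/flats].
- by rewrite pAF.
- case=> [_|i]; last exact: ss.
  by apply/semiE => //; exact: proper_sub.
case=> [|i]; last exact: dec.
case: Fs {IH ss dec} flats pFs lastG lt_slope => //= F2 Fs flats /andP[pFF2 _] _ lt_slope _.
have fF2 : flat M F2 by apply: flats; rewrite !inE eqxx !orbT.
by rewrite /gr /= !slopeE // proper_sub.
Qed.

End Translation.

(** There are finitely many rays, so a single [N] bounds the absolute values of all thresholds, and
    the window from [-N] to [N] has length [N + N]. *)
Lemma uniform_filt_bounds (R : realType) (T : finType) s (E : sheaf_data R T s) :
    tropical_toric_reflexive_sheaf E ->
  exists (lo : int) (m : nat),
    (forall i (j : int), j <= lo -> filt E i j = ground (vmat E)) /\
    (forall i (j : int), lo + m%:Z <= j -> filt E i j = set0).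
Proof.
move=> [_ _ _ /fin_all_exists[hi hiP] /fin_all_exists[lo loP]].
pose N := (\max_(i < s) maxn `|hi i| `|lo i|)%N.
have leN i : (`|hi i| <= N)%N /\ (`|lo i| <= N)%N.
  by apply/andP; rewrite -geq_max; apply: (leq_bigmax_cond i).
exists (- N%:Z), (N + N)%N; split=> i j le_j; [apply: loP|apply: hiP]; have := leN i; lia.
Qed.

Theorem theorem7p25 (R : realType) (n s : nat)
    (Sigma : simplicial_fan R n s) (complete_Sigma : complete_fan Sigma)
    (d : chow_degree Sigma) (H : 'I_s -> int) (ample_H : ample Sigma H)
    (T : finType) (E : sheaf_data R T s)
    (sheaf_E : tropical_toric_reflexive_sheaf E)
    (modular_E : forall (i : 'I_s) (j : int),
       modular_flat (vmat E) (filt E i j)) :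
  (exists Fs : seq {set T}, Harder_Narasimhan (curve_degree d H) E Fs) /\
  (forall Fs Fs' : seq {set T},
     Harder_Narasimhan (curve_degree d H) E Fs ->
     Harder_Narasimhan (curve_degree d H) E Fs' ->
     (forall F, F \in Fs -> modular_flat (vmat E) F) ->
     (forall F, F \in Fs' -> modular_flat (vmat E) F) ->
     Fs = Fs').
Proof.
have [lo [m [filt_lo filt_hi]]] := uniform_filt_bounds sheaf_E.
have [[rk1 _] _ _ _ _] := sheaf_E.
(* Simplicity excludes loops, so the empty set is closed. *)
have flat0 : flat (vmat E) set0.
  by apply/flatP; split=> [|e eG]; rewrite ?sub0set // setU0 rk1 // rk0.
have HNP Fs := HN_chainP (curve_degree d H) filt_lo filt_hi modular_E Fs flat0.
have HN_iff Fs : Harder_Narasimhan (curve_degree d H) E Fs <->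
    HN_chain (vmat E) (flat_degree (curve_degree d H) E) set0 Fs.
  rewrite -HNP; split=> [[[fl pa la] ss dec]|[fl pa la ss dec]]; do 2?split=> //.
have h_ge0 := curve_degree_ge0 d ample_H.
have supermod := flat_degree_supermodular filt_lo filt_hi modular_E h_ge0.
split.
  by have [Fs /HN_iff] := HN_chain_exists (flat_degree (curve_degree d H) E) flat0; exists Fs.
move=> Fs Fs' /HN_iff ch /HN_iff ch'.
exact: (HN_chain_unique supermod flat0 ch ch').
Qed.
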